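(* Let $m\ge1$ be an integer, let $c_1,c_2,c_3$ be nonzero real numbers, and for $k=1,2,3$ let $\boldsymbol a_k$ and $\boldsymbol b_k$ be real tuples of sizes $i_k\ge0$ and $j_k\ge0$ respectively. Assume that $${}_{j_1}F_{i_1}\left(\begin{smallmatrix}-m\boldsymbol b_1\\ -m\boldsymbol a_1\end{smallmatrix};c_1x\right)\,{}_{j_2}F_{i_2}\left(\begin{smallmatrix}-m\boldsymbol b_2\\ -m\boldsymbol a_2\end{smallmatrix};c_2x\right)={}_{j_3}F_{i_3}\left(\begin{smallmatrix}-m\boldsymbol b_3\\ -m\boldsymbol a_3\end{smallmatrix};c_3x\right).$$ Then, with $s_k=\sqrt{c_k(-1)^{i_k+j_k+1}}$ for $k=1,2,3$, $$\operatorname{Dil}_{s_1}\mathcal H_m^E\left[\begin{smallmatrix}\boldsymbol b_1,\ 1-\frac1{2m}\\ \boldsymbol a_1\end{smallmatrix}\right]\boxplus_{2m}\operatorname{Dil}_{s_2}\mathcal H_m^E\left[\begin{smallmatrix}\boldsymbol b_2,\ 1-\frac1{2m}\\ \boldsymbol a_2\end{smallmatrix}\right]=\operatorname{Dil}_{s_3}\mathcal H_m^E\left[\begin{smallmatrix}\boldsymbol b_3,\ 1-\frac1{2m}\\ \boldsymbol a_3\end{smallmatrix}\right].$$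
   Context: $\mathcal P_n$ is the set of monic polynomials of degree $n$ over $\mathbb C$. For $p\in\mathcal P_n$ the coefficients $\mathsf e_k(p)$ are defined by $p(x)=\sum_{k=0}^n x^{n-k}(-1)^k\mathsf e_k(p)$. For a nonzero complex scalar $\alpha$, $[\operatorname{Dil}_\alpha p](x)=\alpha^np(\alpha^{-1}x)$. (For an even polynomial of even degree, $\operatorname{Dil}_\alpha$ and $\operatorname{Dil}_{-\alpha}$ agree, so the choice of square roots, possibly complex, is immaterial.) Falling and rising factorials: $(a)^{\underline k}=a(a-1)\cdots(a-k+1)$, $(a)^{\overline k}=a(a+1)\cdots(a+k-1)$; for tuples these denote products over the entries (equal to $1$ for the empty tuple), and $c\boldsymbol a$ denotes entrywise multiplication. Generalized hypergeometric series: ${}_jF_i\left(\begin{smallmatrix}\boldsymbol b\\ \boldsymbol a\end{smallmatrix};x\right)=\sum_{k\ge0}\frac{(\boldsymbol b)^{\overline k}}{(\boldsymbol a)^{\overline k}}\frac{x^k}{k!}$, regarded as a formal power series; the assumed identity is one of formal power series in $x$ and includes the assumption that the series are well defined (no denominator vanishes). Hypergeometric polynomials: for a real tuple $\boldsymbol b$ and a real tuple $\boldsymbol a$ with no entry in $\{0,\frac1m,\dots,\frac{m-1}m\}$, $\mathcal H_m\left[\begin{smallmatrix}\boldsymbol b\\ \boldsymbol a\end{smallmatrix}\right]\in\mathcal P_m$ is the monic polynomial with $\mathsf e_k=\binom mk\frac{(m\boldsymbol b)^{\underline k}}{(m\boldsymbol a)^{\underline k}}$, $0\le k\le m$. Its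 even version is $\mathcal H_m^E\left[\begin{smallmatrix}\boldsymbol b\\ \boldsymbol a\end{smallmatrix}\right](x)=\mathcal H_m\left[\begin{smallmatrix}\boldsymbol b\\ \boldsymbol a\end{smallmatrix}\right](x^2)\in\mathcal P_{2m}$. Finite free additive convolution on $\mathcal P_n$: $\mathsf e_k(p\boxplus_n q)=(n)^{\underline k}\sum_{i+j=k}\frac{\mathsf e_i(p)\mathsf e_j(q)}{(n)^{\underline i}(n)^{\underline j}}$ for $0\le k\le n$. *)

(* Defs.v *)
From HB Require Import structures.
From mathcomp Require Import all_boot all_order all_algebra.
From mathcomp Require Import reals complex.
Set Implicit Arguments.
Unset Strict Implicit.
Unset Printing Implicit Defensive.
Import Order.TTheory GRing.Theory Num.Theory.
Local Open Scope ring_scope.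
Local Open Scope complex_scope.

Section Factorials.
Variable F : fieldType.

Definition falling (a : F) (k : nat) : F := \prod_(l < k) (a - l%:R).
Definition rising (a : F) (k : nat) : F := \prod_(l < k) (a + l%:R).

Definition fallings (s : seq F) (k : nat) : F := \prod_(a <- s) falling a k.
Definition risings (s : seq F) (k : nat) : F := \prod_(a <- s) rising a k.

Definition scale_seq (c : F) (s : seq F) : seq F := [seq c * a | a <- s].

End Factorials.

Section FormalSeries.
Variable F : fieldType.

(* A formal power series is its sequence of coefficients. *)
Definition fps := nat -> F.

Definition fps_mul (u v : fps) : fps :=
  fun n => \sum_(i < n.+1) u i * v (n - i)%N.

(* u(c x) *)
Definition fps_dilate (c : F) (u : fps) : fps := fun k => u k * c ^+ k.

(* No denominator of jFi(b; a; x) vanishes. *)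
Definition hypergeom_defined (a : seq F) : Prop :=
  forall k : nat, risings a k != 0.

(* The upper parameters b come first, the lower parameters a second; only
   meaningful when [hypergeom_defined a] holds. *)
Definition hypergeom (b a : seq F) : fps :=
  fun k => risings b k / risings a k / (k`!)%:R.

End FormalSeries.

Section MonicPolynomials.
Variable F : fieldType.

(* The monic polynomials of degree n. *)
Definition monic_deg (n : nat) : {pred {poly F}} :=
  [pred p : {poly F} | (p \is monic) && (size p == n.+1)].

(* The coefficient e_k(p) of a polynomial p regarded as having degree n, for
   k <= n; see [monic_degE]. *)
Definition ecoef (n : nat) (p : {poly F}) (k : nat) : F :=
  (-1) ^+ k * p`_(n - k).

Definition poly_of_ecoef (n : nat) (e : nat -> F) : {poly F} :=
  \sum_(k < n.+1) ((-1) ^+ k * e k) *: 'X^(n - k).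

Lemma coef_poly_of_ecoef n e k : (k <= n)%N ->
  (poly_of_ecoef n e)`_(n - k) = (-1) ^+ k * e k.
Proof.
move=> le_kn; have lt_kn : (k < n.+1)%N by [].
rewrite coef_sum (bigD1 (Ordinal lt_kn)) //= coefZ coefXn eqxx mulr1.
rewrite big1 ?addr0 // => i ne_ik; rewrite coefZ coefXn.
case: eqP => [eq_ik|_]; last by rewrite mulr0.
case/eqP: ne_ik; apply: val_inj => /=.
by rewrite -(subKn le_kn) eq_ik subKn // -ltnS.
Qed.

Lemma ecoef_poly_of_ecoef n e k : (k <= n)%N ->
  ecoef n (poly_of_ecoef n e) k = e k.
Proof.
by move=> le_kn; rewrite /ecoef coef_poly_of_ecoef // mulrA -expr2 sqrr_sign mul1r.
Qed.

Lemma monic_degE n p : p \in monic_deg n -> p = poly_of_ecoef n (ecoef n p).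
Proof.
rewrite inE => /andP[_ /eqP sz_p]; rewrite /poly_of_ecoef /ecoef.
rewrite -[LHS]coefK sz_p poly_def (reindex_inj rev_ord_inj) /=.
by apply: eq_bigr => i _; rewrite subSS mulrA -expr2 sqrr_sign mul1r.
Qed.

Lemma monic_deg_poly_of_ecoef n e : e 0%N = 1 -> poly_of_ecoef n e \in monic_deg n.
Proof.
move=> e0; have lc : (poly_of_ecoef n e)`_n = 1.
  by have := coef_poly_of_ecoef e (leq0n n); rewrite subn0 e0 expr0 mul1r.
have sz : size (poly_of_ecoef n e) = n.+1.
  apply/eqP; rewrite eqn_leq; apply/andP; split.
    apply: (leq_trans (size_sum _ _ _)); apply/bigmax_leqP => i _.
    by apply: (leq_trans (size_scale_leq _ _)); rewrite size_polyXn ltnS leq_subr.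
  rewrite ltnNge; apply/negP => /leq_sizeP/(_ n (leqnn n)).
  by rewrite lc => /eqP; rewrite oner_eq0.
by rewrite inE monicE lead_coefE sz /= lc !eqxx.
Qed.

(* On polynomials of degree n, for alpha != 0. *)
Definition Dil (n : nat) (alpha : F) (p : {poly F}) : {poly F} :=
  alpha ^+ n *: (p \Po (alpha^-1 *: 'X)).

(* Finite free additive convolution on [monic_deg n]. *)
Definition ff_add_conv (n : nat) (p q : {poly F}) : {poly F} :=
  poly_of_ecoef n (fun k =>
    (n ^_ k)%:R * \sum_(i < k.+1)
      ecoef n p i * ecoef n q (k - i) / ((n ^_ i)%:R * (n ^_ (k - i))%:R)).

Lemma ff_add_conv_monic n p q : p \in monic_deg n -> q \in monic_deg n ->
  ff_add_conv n p q \in monic_deg n.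
Proof.
rewrite !inE => /andP[/monicP pm /eqP sp] /andP[/monicP qm /eqP sq].
apply: monic_deg_poly_of_ecoef; rewrite big_ord_recl big_ord0 /ecoef !subn0.
move: pm qm; rewrite !lead_coefE sp sq /= => -> ->.
by rewrite ffactn0 !expr0 !mulr1 addr0 mul1r divr1.
Qed.

End MonicPolynomials.

Section HypergeometricPolynomials.
Variable R : realType.

(* Only meaningful when no entry of a lies in {0, 1/m, ..., (m-1)/m}. *)
Definition hyp_poly (m : nat) (b a : seq R) : {poly R[i]} :=
  poly_of_ecoef m (fun k =>
    ('C(m, k)%:R * fallings (scale_seq m%:R b) k
                 / fallings (scale_seq m%:R a) k)%:C).

Lemma hyp_poly_monic m b a : hyp_poly m b a \in monic_deg m.
Proof.
apply: monic_deg_poly_of_ecoef; rewrite bin0 mul1r /fallings.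
by rewrite !big1 ?divr1 // => x _; rewrite /falling big_ord0.
Qed.

Definition hyp_poly_even (m : nat) (b a : seq R) : {poly R[i]} :=
  hyp_poly m b a \Po 'X^2.

End HypergeometricPolynomials.

(* Main.v *)
Require Import Defs.
From HB Require Import structures.
From mathcomp Require Import all_boot all_order all_algebra.
From mathcomp Require Import reals complex.
From mathcomp Require Import ring zify.
Set Implicit Arguments.
Unset Strict Implicit.
Unset Printing Implicit Defensive.
Import Order.TTheory GRing.Theory Num.Theory.
Local Open Scope ring_scope.
Local Open Scope complex_scope.

(** Divide the coefficient e_k(p) of a polynomial of degree n by the falling
    factorial of n.  Finite free additive convolution in degree n then becomes
    the product of power series truncated at order n
    ([ecoef_ff_add_conv_normalized]).  For the dilated even hypergeometric
    polynomial of degree 2m with upper parameters b, 1 - 1/(2m) and lower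
    parameters a, the normalized series is the truncation of
      F(-m b; -m a; c x^2 / 4)   ([ecoef_normalized_hyp_even]).
    The identity responsible for this is
      (2m)_(2k) = 4^k (m)_k (m - 1/2)_k   for falling factorials
    ([ffact_double]): the extra parameter 1 - 1/(2m) contributes (m - 1/2)_k, so
    the binomial coefficient and the normalization leave only 1 / (4^k k!).
    The signs in s^2 cancel the factor (-1)^k by which e_(2k)(p(x^2)) differs from
    e_k(p), and those produced by replacing falling factorials of m b and m a by
    rising factorials of their opposites.  The assumed product formula
    for the three series, evaluated at x^2 / 4, is therefore the claim, since the
    coefficients e_0, ..., e_(2m) determine the polynomial. *)

Section Series.
Variable F : fieldType.
Implicit Types u v w : fps F.

(** The power series u(x^2). *)
Definition fps_subst_sqr u : fps F :=
  fun k => if odd k then 0 else u k./2.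

Lemma sum_even_index (G : nat -> F) n : (forall i, odd i -> G i = 0) ->
  \sum_(i < n.*2.+1) G i = \sum_(i < n.+1) G i.*2.
Proof.
move=> G0; elim: n => [|n IHn]; first by rewrite !big_ord1.
rewrite doubleS big_ord_recr big_ord_recr /= IHn G0 /= ?odd_double // addr0.
by rewrite [RHS]big_ord_recr /= doubleS.
Qed.

Lemma fps_mul_subst_sqr u v :
  fps_mul (fps_subst_sqr u) (fps_subst_sqr v) =1 fps_subst_sqr (fps_mul u v).
Proof.
move=> k; rewrite /fps_mul /fps_subst_sqr; case: ifPn => [odd_k|even_k].
  apply: big1 => i _; have le_ik : (i <= k)%N by rewrite -ltnS.
  by rewrite oddB // odd_k; case: (odd i); rewrite ?mul0r ?mulr0.
rewrite -(even_halfK even_k) doubleK; move: k./2 => j.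
rewrite (sum_even_index (G := fun i =>
  (if odd i then 0 else u i./2) * (if odd (j.*2 - i) then 0 else v (j.*2 - i)./2))).
  by apply: eq_bigr => i _; rewrite -doubleB !odd_double !doubleK.
by move=> i ->; rewrite mul0r.
Qed.

Lemma fps_mul_dilate d u v :
  fps_mul (fps_dilate d u) (fps_dilate d v) =1 fps_dilate d (fps_mul u v).
Proof.
move=> k; rewrite /fps_mul /fps_dilate mulr_suml; apply: eq_bigr => i _.
have le_ik : (i <= k)%N by rewrite -ltnS.
have -> : d ^+ k = d ^+ i * d ^+ (k - i) by rewrite -exprD subnKC.
by ring.
Qed.

End Series.

Section Coefficients.
Variable F : fieldType.
Implicit Types p q : {poly F}.

Lemma monic_deg_ecoef_inj n p q : p \in monic_deg n -> q \in monic_deg n ->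
  (forall k, (k <= n)%N -> ecoef n p k = ecoef n q k) -> p = q.
Proof.
move=> p_n q_n eq_pq; rewrite (monic_degE p_n) (monic_degE q_n).
apply: eq_bigr => i _.
by rewrite eq_pq // -ltnS.
Qed.

Lemma coef_comp_scaleX p a k : (p \Po (a *: 'X))`_k = p`_k * a ^+ k.
Proof.
rewrite coef_comp_poly.
under eq_bigr do rewrite exprZn coefZ coefXn.
have [lt_kp|le_pk] := ltnP k (size p).
  rewrite (bigD1 (Ordinal lt_kp)) //= eqxx mulr1 big1 ?addr0 // => i ne_ik.
  case: eqP => [eq_ki|_]; last by rewrite !mulr0.
  by case/eqP: ne_ik; apply: val_inj.
rewrite nth_default // mul0r big1 // => i _.
case: eqP => [eq_ki|_]; last by rewrite !mulr0.
by have := ltn_ord i; rewrite -eq_ki ltnNge le_pk.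
Qed.

Lemma ecoef_Dil n s p k : s != 0 -> (k <= n)%N ->
  ecoef n (Dil n s p) k = s ^+ k * ecoef n p k.
Proof.
move=> s0 le_kn; rewrite /ecoef /Dil coefZ coef_comp_scaleX.
rewrite exprVn -{1}(subnK le_kn) exprD.
by field; rewrite expf_neq0.
Qed.

Lemma Dil_monic n s p : s != 0 -> p \in monic_deg n -> Dil n s p \in monic_deg n.
Proof.
move=> s0; rewrite !inE => /andP[/monicP lcp /eqP szp].
have szX : size (s^-1 *: 'X : {poly F}) = 2.
  by rewrite size_scale ?invr_eq0 // size_polyX.
rewrite monicE lead_coefZ lead_coef_comp ?szX // lcp szp lead_coefZ lead_coefX /=.
rewrite mul1r mulr1 exprVn divff ?expf_neq0 //= eqxx /=.
by rewrite size_scale ?expf_neq0 // size_comp_poly2 // szp.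
Qed.

Lemma comp_sqr_monic m p : p \in monic_deg m ->
  p \Po 'X^2 \in monic_deg (2 * m).
Proof.
rewrite !inE => /andP[/monicP lcp /eqP szp].
have szX : size ('X^2 : {poly F}) = 3 by rewrite size_polyXn.
rewrite monicE lead_coef_comp ?szX // lcp szp lead_coefXn expr1n mulr1 eqxx /=.
have := size_comp_poly p 'X^2; rewrite szX szp /= mulnC => szpX.
have: p \Po 'X^2 != 0 by rewrite -lead_coef_eq0 lead_coef_comp ?szX // lcp
  lead_coefXn expr1n mulr1 oner_neq0.
by rewrite -size_poly_gt0 => /prednK <-; rewrite szpX.
Qed.

Lemma ecoef_comp_sqr m p k : (k <= 2 * m)%N ->
  ecoef (2 * m) (p \Po 'X^2) k =
  if odd k then 0 else (-1) ^+ k./2 * ecoef m p k./2.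
Proof.
move=> le_k; rewrite /ecoef coef_comp_poly_Xn // dvdn2 oddB // mul2n odd_double /=.
have [odd_k|even_k] := boolP (odd k); first by rewrite mulr0.
rewrite -{1 2}(even_halfK even_k) -doubleB divn2 doubleK.
by rewrite -muln2 mulnC exprM sqrrN expr1n expr1n mul1r mulrA -expr2 sqrr_sign mul1r.
Qed.

(** The power series with coefficients e_k(p) / (n)_k, where p is regarded as
    having degree n.  Beyond order n the denominators vanish and the coefficients
    are 0. *)
Definition ecoef_normalized n p : fps F := fun k => ecoef n p k / (n ^_ k)%:R.

Lemma ecoef_ff_add_conv_normalized n p q k : (k <= n)%N ->
  ecoef n (ff_add_conv n p q) k =
  (n ^_ k)%:R * fps_mul (ecoef_normalized n p) (ecoef_normalized n q) k.
Proof.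
move=> le_kn; rewrite ecoef_poly_of_ecoef //; congr (_ * _); apply: eq_bigr => i _.
by rewrite mulf_div.
Qed.

Lemma risingsN (s : seq F) k :
  risings [seq - x | x <- s] k = (-1) ^+ (size s * k) * fallings s k.
Proof.
rewrite /risings /fallings big_map; elim: s => [|x s IHs].
  by rewrite !big_nil mul0n mulr1.
rewrite !big_cons {}IHs mulSn exprD.
suff ->: rising (- x) k = (-1) ^+ k * falling x k by ring.
rewrite /rising /falling; elim: k => [|k IHk]; first by rewrite !big_ord0 mulr1.
by rewrite !big_ord_recr /= IHk exprS; ring.
Qed.

Lemma scale_seqN (c : F) s : scale_seq (- c) s = [seq - x | x <- scale_seq c s].
Proof. by rewrite /scale_seq -map_comp; apply: eq_map => x /=; rewrite mulNr. Qed.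

Lemma scale_seq_rcons (c : F) s x :
  scale_seq c (rcons s x) = rcons (scale_seq c s) (c * x).
Proof. exact: map_rcons. Qed.

Lemma fallings_rcons (s : seq F) x k : fallings (rcons s x) k = fallings s k * falling x k.
Proof. by rewrite /fallings -cats1 big_cat big_seq1. Qed.

End Coefficients.

(** Among the factors 2m - l, l < 2k, those with l even multiply to 2^k (m)_k and
    those with l odd to 2^k (m - 1/2)_k. *)
Lemma ffact_double (F : numFieldType) m k : (k <= m)%N ->
  ((2 * m) ^_ (2 * k))%:R =
  4%:R ^+ k * (m ^_ k)%:R * falling (m%:R - 2%:R^-1 : F) k :> F.
Proof.
elim: k => [|k IHk] lt_km; first by rewrite muln0 !ffactn0 /falling big_ord0 !mulr1.
rewrite mulnS !addSn add0n !ffactnSr /falling big_ord_recr /= -/(falling _ k) exprS.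
rewrite !natrM IHk ?(ltnW lt_km) // !natrB; try lia.
rewrite -natr1 !natrM.
by field.
Qed.

Section EvenHypergeometric.
Variable R : realType.

Lemma signed_sqrt_neq0 (c : R) (s : R[i]) n :
  c != 0 -> s ^+ 2 = (c * (-1) ^+ n)%:C -> s != 0.
Proof.
move=> c0 hs; apply/eqP => s0; move/eqP: hs; rewrite s0 expr0n /= eq_sym.
by rewrite fmorph_eq0 mulf_eq0 signr_eq0 (negPf c0).
Qed.

Lemma Dil_hyp_poly_even_monic m (b a : seq R) (s : R[i]) : s != 0 ->
  Dil (2 * m) s (hyp_poly_even m b a) \in monic_deg (2 * m).
Proof. by move=> s0; apply/Dil_monic/comp_sqr_monic/hyp_poly_monic. Qed.

(** The normalized coefficients of the dilated even hypergeometric polynomial are,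
    up to order 2m, those of F(-m b; -m a; c x^2 / 4). *)
Lemma ecoef_normalized_hyp_even m i j (b : j.-tuple R) (a : i.-tuple R)
  (c : R) (s : R[i]) k :
  (1 <= m)%N -> c != 0 -> s ^+ 2 = (c * (-1) ^+ (i + j + 1))%:C ->
  (k <= 2 * m)%N ->
  ecoef_normalized (2 * m)
    (Dil (2 * m) s (hyp_poly_even m (rcons b (1 - (2 * m)%N%:R^-1)) a)) k =
  (fps_subst_sqr (fps_dilate 4%:R^-1
    (fps_dilate c (hypergeom (scale_seq (- m%:R) b) (scale_seq (- m%:R) a)))) k)%:C.
Proof.
move=> m1 c0 hs le_k.
have s0 : s != 0 by apply: signed_sqrt_neq0 c0 hs.
rewrite /ecoef_normalized ecoef_Dil // /hyp_poly_even ecoef_comp_sqr // /fps_subst_sqr.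
have [_|even_k] := boolP (odd k); first by rewrite mulr0 mul0r.
have Ek : k = (2 * k./2)%N by rewrite mul2n even_halfK.
move: (k./2) Ek => l Ek; subst k.
have le_l : (l <= m)%N by lia.
rewrite ecoef_poly_of_ecoef // exprM hs.
rewrite /fps_dilate /hypergeom !scale_seqN !risingsN.
rewrite scale_seq_rcons fallings_rcons.
rewrite size_map !size_tuple.
have -> : m%:R * (1 - (2 * m)%:R^-1) = m%:R - 2^-1 :> R.
  by rewrite natrM; field; rewrite pnatr_eq0 -lt0n.
rewrite -(rmorph_nat (real_complex R)) -(rmorph_sign (real_complex R)).
rewrite -!rmorphXn -fmorphV -!rmorphM; congr (_%:C).
have ff0 : ((2 * m) ^_ (2 * l))%:R != 0 :> R.
  by rewrite pnatr_eq0 -lt0n ffact_gt0; lia.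
have hd := ffact_double R le_l; rewrite hd !mulf_eq0 !negb_or -andbA in ff0.
case/and3P: ff0 => f1 f2 f3; rewrite hd -bin_ffact natrM in f2 *.
have f4 : 'C(m, l)%:R != 0 :> R by move: f2; rewrite mulf_eq0 negb_or => /andP[].
have f5 : l`!%:R != 0 :> R by move: f2; rewrite mulf_eq0 negb_or => /andP[].
have sgn t : ((-1) ^+ t)^-1 = (-1) ^+ t :> R by rewrite -signr_odd invr_sign.
rewrite [in RHS]invfM sgn exprMn -exprM !mulnDl mul1n !exprD exprVn.
(* The falling factorial of m a is not assumed nonzero, so its inverse is kept as
   a single factor. *)
move: (fallings _ l)^-1 => ia.
have -> : forall x y z t w : R, x * (y * z * (-1) ^+ l) * ((-1) ^+ l * t) / w
    = x * (y * z) * t / w.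
  move=> x y z t w; rewrite -[RHS]mulr1 -[X in _ = _ * X](sqrr_sign R l); ring.
by field; rewrite f5 f3 f4 f1.
Qed.

End EvenHypergeometric.

(* s1, s2, s3 range over all complex square roots of the given numbers. *)
Theorem proposition4p12 (R : realType) (m : nat) (hm : (1 <= m)%N)
  (c1 c2 c3 : R) (hc1 : c1 != 0) (hc2 : c2 != 0) (hc3 : c3 != 0)
  (i1 i2 i3 j1 j2 j3 : nat)
  (a1 : i1.-tuple R) (a2 : i2.-tuple R) (a3 : i3.-tuple R)
  (b1 : j1.-tuple R) (b2 : j2.-tuple R) (b3 : j3.-tuple R)
  (ha1 : hypergeom_defined (scale_seq (- m%:R) a1))
  (ha2 : hypergeom_defined (scale_seq (- m%:R) a2))
  (ha3 : hypergeom_defined (scale_seq (- m%:R) a3))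
  (hF : fps_mul
          (fps_dilate c1 (hypergeom (scale_seq (- m%:R) b1) (scale_seq (- m%:R) a1)))
          (fps_dilate c2 (hypergeom (scale_seq (- m%:R) b2) (scale_seq (- m%:R) a2)))
        =1 fps_dilate c3 (hypergeom (scale_seq (- m%:R) b3) (scale_seq (- m%:R) a3)))
  (s1 s2 s3 : R[i])
  (hs1 : s1 ^+ 2 = (c1 * (-1) ^+ (i1 + j1 + 1))%:C)
  (hs2 : s2 ^+ 2 = (c2 * (-1) ^+ (i2 + j2 + 1))%:C)
  (hs3 : s3 ^+ 2 = (c3 * (-1) ^+ (i3 + j3 + 1))%:C) :
  ff_add_conv (2 * m)%N
    (Dil (2 * m)%N s1 (hyp_poly_even m (rcons b1 (1 - (2 * m)%N%:R^-1)) a1))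
    (Dil (2 * m)%N s2 (hyp_poly_even m (rcons b2 (1 - (2 * m)%N%:R^-1)) a2))
  = Dil (2 * m)%N s3 (hyp_poly_even m (rcons b3 (1 - (2 * m)%N%:R^-1)) a3).
Proof.
have d1 := signed_sqrt_neq0 hc1 hs1; have d2 := signed_sqrt_neq0 hc2 hs2.
have d3 := signed_sqrt_neq0 hc3 hs3.
apply: (@monic_deg_ecoef_inj _ (2 * m)) => [||k le_k].
- by apply: ff_add_conv_monic; apply: Dil_hyp_poly_even_monic.
- exact: Dil_hyp_poly_even_monic.
have nz : ((2 * m) ^_ k)%:R != 0 :> R[i] by rewrite pnatr_eq0 -lt0n ffact_gt0.
rewrite ecoef_ff_add_conv_normalized // -[RHS](divfK nz) mulrC; congr (_ * _).
rewrite -/(ecoef_normalized _ _ _) (ecoef_normalized_hyp_even b3 a3 hm hc3 hs3) //.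
have <- : fps_subst_sqr (fps_dilate 4^-1 (fps_mul
    (fps_dilate c1 (hypergeom (scale_seq (- m%:R) b1) (scale_seq (- m%:R) a1)))
    (fps_dilate c2 (hypergeom (scale_seq (- m%:R) b2) (scale_seq (- m%:R) a2))))) k
  = fps_subst_sqr (fps_dilate 4^-1
      (fps_dilate c3 (hypergeom (scale_seq (- m%:R) b3) (scale_seq (- m%:R) a3)))) k.
  by rewrite /fps_subst_sqr {1}/fps_dilate hF.
set u1 := fps_dilate c1 _; set u2 := fps_dilate c2 _.
have -> : fps_subst_sqr (fps_dilate 4^-1 (fps_mul u1 u2)) k
  = fps_mul (fps_subst_sqr (fps_dilate 4^-1 u1))
            (fps_subst_sqr (fps_dilate 4^-1 u2)) k.
  by rewrite fps_mul_subst_sqr /fps_subst_sqr fps_mul_dilate.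
rewrite /fps_mul rmorph_sum; apply: eq_bigr => i _.
have le_ik : (i <= k)%N by rewrite -ltnS.
rewrite (ecoef_normalized_hyp_even b1 a1 hm hc1 hs1).
  rewrite (ecoef_normalized_hyp_even b2 a2 hm hc2 hs2) ?rmorphM //.
  exact: leq_trans (leq_subr _ _) le_k.
exact: leq_trans le_k.
Qed.
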